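(* For every integer $n\ge 5$, the boxicity of the Kneser graph $\mathrm{KG}(n,2)$ equals $n-2$. In particular, the boxicity of the Petersen graph $\mathrm{KG}(5,2)$ is $3$.
   Context: All graphs are finite and simple. For integers $n\ge 2k+1$, the Kneser graph $\mathrm{KG}(n,k)$ has as vertices all $k$-element subsets of $\{1,\dots,n\}$, two vertices being adjacent iff the corresponding subsets are disjoint. The boxicity $\mathrm{box}(G)$ of a graph $G$ is the minimum $d\ge 0$ such that $G$ is the intersection graph of a family of axis-parallel boxes in $\mathbb{R}^d$ (products of $d$ closed real intervals), i.e. there is an assignment of boxes to vertices such that two distinct vertices are adjacent iff their boxes intersect. *)

(* Defs.v *)
From HB Require Import structures.
From mathcomp Require Import all_boot all_order all_algebra.
From mathcomp Require Import boolp classical_sets reals.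

Set Implicit Arguments.
Unset Strict Implicit.
Unset Printing Implicit Defensive.

Import Order.TTheory GRing.Theory Num.Theory.

Local Open Scope classical_set_scope.
Local Open Scope ring_scope.

Record sgraph := SGraph {
  svertex :> finType;
  adj : rel svertex;
  adj_sym : symmetric adj;
  adj_irrefl : irreflexive adj }.

Section Boxicity.
Variable R : realType.

(* The intervals are required to be nonempty. For d = 0 the only box is the
   one-point space itself. *)
Definition is_box d (B : set 'rV[R]_d) : Prop :=
  exists lo hi : 'rV[R]_d,
    (forall i, lo 0 i <= hi 0 i) /\
    B = [set x | forall i, x 0 i \in `[lo 0 i, hi 0 i]].

Definition box_representable (G : sgraph) (d : nat) : Prop :=
  exists B : G -> set 'rV[R]_d,
    (forall v, is_box (B v)) /\
    (forall u v, u != v -> (adj u v <-> B u `&` B v !=set0)).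

(* One coordinate per vertex w: w gets [0, 0], its neighbours get [0, 1] and
   all other vertices get [1, 1]. *)
Lemma box_representable_card (G : sgraph) : box_representable G #|G|.
Proof.
pose lo (v : G) : 'rV[R]_#|G| :=
  \row_i (if (v == enum_val i) || adj v (enum_val i) then 0 else 1).
pose hi (v : G) : 'rV[R]_#|G| := \row_i (if v == enum_val i then 0 else 1).
exists (fun v => [set x | forall i, x 0 i \in `[lo v 0 i, hi v 0 i]]).
split=> [v|u v neq_uv].
  exists (lo v), (hi v); split=> // i.
  by rewrite !mxE; case: eqP => //= _; case: ifP.
split=> [uv|[x [/= xu xv]]].
  exists (\row_i (if (u == enum_val i) || (v == enum_val i) then 0 else 1)).
  split=> i; rewrite !mxE in_itv /=.
    have [->|neu] := eqVneq u (enum_val i); first by rewrite /= lexx.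
    have [<-|nev] /= := eqVneq v (enum_val i); first by rewrite uv lexx ler01.
    by case: ifP; rewrite ?ler01 lexx.
  have [->|nev] := eqVneq v (enum_val i); first by rewrite orbT /= lexx.
  have [<-|neu] /= := eqVneq u (enum_val i).
    by rewrite adj_sym uv lexx ler01.
  by case: ifP; rewrite ?ler01 lexx.
apply: contraT => nuv.
have := xu (enum_rank u); have := xv (enum_rank u).
rewrite !mxE !in_itv /= !enum_rankK eqxx /= (eq_sym v) (negPf neq_uv) /=.
rewrite adj_sym (negPf nuv) => /andP[x1 _] /andP[_ x0].
by have := le_trans x1 x0; rewrite ler10.
Qed.

Lemma box_representable_ex (G : sgraph) :
  exists d, `[< box_representable G d >].
Proof. by exists #|G|; apply/asboolP; exact: box_representable_card. Qed.

Definition boxicity (G : sgraph) : nat := ex_minn (box_representable_ex G).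

End Boxicity.

Section Kneser.
Variables n k : nat.

Definition kneser_vertex := {A : {set 'I_n} | #|A| == k}.

(* The condition A != B only matters for k = 0: a nonempty set is never
   disjoint from itself. *)
Definition kneser_adj : rel kneser_vertex :=
  fun A B => (A != B) && [disjoint val A & val B].

Lemma kneser_adj_sym : symmetric kneser_adj.
Proof. by move=> A B; rewrite /kneser_adj eq_sym disjoint_sym. Qed.

Lemma kneser_adj_irrefl : irreflexive kneser_adj.
Proof. by move=> A; rewrite /kneser_adj eqxx. Qed.

Definition kneser : sgraph := SGraph kneser_adj_sym kneser_adj_irrefl.

End Kneser.

(* Main.v *)
Require Import Defs.
From HB Require Import structures.
From mathcomp Require Import all_boot all_order all_algebra.
From mathcomp Require Import boolp classical_sets reals.
From mathcomp Require Import fintype finset zify.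

Set Implicit Arguments.
Unset Strict Implicit.
Unset Printing Implicit Defensive.

Import Order.TTheory GRing.Theory Num.Theory.

(* Each coordinate of a box representation of KG(n, 2) puts an interval order
   on the edges of K_n in which only meeting edges are comparable, and every
   cherry (pair of meeting edges) is comparable in some coordinate; so n - 3
   such orders must be shown not to suffice.  In one such order let ab have the
   smallest right end and ac the largest left end.  If g < h then h meets ab and
   g meets ac, so every comparable cherry contains a or contains both b and c.
   If all of them contain a, delete the vertex a together with this order and
   induct.  Otherwise the order touches at most 3n - 8 triples of vertices and
   fills at most 2, or touches at most 2n - 4 and fills at most the four triples
   of a 4-set.  A triple is filled by one order or touched by two, so the sum of
   the numbers of touched and filled triples is at least 2 C(n, 3), which
   exceeds what n - 3 orders achieve.  The only tight case is n = 5 with two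
   orders that both fill the triples of a 4-set; then some triple is filled
   twice.

   For the upper bound there is one coordinate for every vertex c other than two
   fixed vertices: the edges at c become distinct points, the edges from c to
   the two fixed vertices being the extreme ones. *)

(** * Interval orders on the edges of a complete graph *)

(* [lt x y z t] says that the interval of the edge xy lies to the left of that
   of zt. *)
Record edge_order (T : Type) (lt : T -> T -> T -> T -> bool) : Prop := EdgeOrder {
  eo_symL : forall x y z t, lt x y z t -> lt y x z t;
  eo_symR : forall x y z t, lt x y z t -> lt x y t z;
  eo_irr : forall x y, ~ lt x y x y;
  eo_neqL : forall x y z t, lt x y z t -> x <> y;
  eo_neqR : forall x y z t, lt x y z t -> z <> t;
  eo_meet : forall x y z t, lt x y z t -> [\/ x = z, x = t, y = z | y = t];
  eo_ferrers : forall x y z t x' y' z' t',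
    lt x y z t -> lt x' y' z' t' -> lt x y z' t' \/ lt x' y' z t }.

Section EdgeOrder.
Variables (T : finType) (lt : T -> T -> T -> T -> bool).
Hypothesis o : edge_order lt.

Lemma eo_trans x y z t u v : lt x y z t -> lt z t u v -> lt x y u v.
Proof. by move=> h1 h2; case: (eo_ferrers o h1 h2) => // /(eo_irr o). Qed.

Lemma eo_rev : edge_order (fun x y z t => lt z t x y).
Proof.
split=> x y.
- by move=> z t /(eo_symR o).
- by move=> z t /(eo_symL o).
- exact: (eo_irr o).
- by move=> z t /(eo_neqR o).
- by move=> z t /(eo_neqL o).
- by move=> z t /(eo_meet o)[] ->;
    [constructor 1|constructor 3|constructor 2|constructor 4].
- by move=> z t x' y' z' t' h h'; case: (eo_ferrers o h h'); [right|left].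
Qed.

Lemma eo_restrict (S : {set T}) :
  edge_order (fun x y z t => lt x y z t && ([set x; y; z; t] \subset S)).
Proof.
have sub x y z t : ([set x; y; z; t] \subset S) = [&& x \in S, y \in S, z \in S & t \in S].
  by rewrite !subUset !sub1set -!andbA.
split=> [x y z t|x y z t|x y|x y z t|x y z t|x y z t|x y z t x' y' z' t']; rewrite ?sub.
- by case/and5P=> /(eo_symL o)-> -> -> -> ->.
- by case/and5P=> /(eo_symR o)-> -> -> -> ->.
- by case/andP=> /(eo_irr o).
- by case/andP=> /(eo_neqL o).
- by case/andP=> /(eo_neqR o).
- by case/andP=> /(eo_meet o).
- case/and5P=> h -> -> -> -> /and5P[h' -> -> -> ->].
  by case: (eo_ferrers o h h') => ->; [left|right].
Qed.

(** By the Ferrers property the successor sets form a chain under inclusion, so a largest one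
    contains all the others. *)
Lemma eo_min x0 y0 z0 t0 : lt x0 y0 z0 t0 ->
  exists a b, forall x y z t, lt x y z t -> lt a b z t.
Proof.
move=> h0; pose suc (e : T * T) := [set f : T * T | lt e.1 e.2 f.1 f.2].
case: (@arg_maxnP _ (x0, y0) xpredT (fun e => #|suc e|) isT) => -[a b] _ mx.
exists a, b => x y z t h; apply/negPn/negP => nab.
suff: #|suc (a, b)| < #|suc (x, y)| by rewrite ltnNge => /negP; apply; apply: mx.
apply: proper_card; apply/properP; split; last by exists (z, t); rewrite inE.
apply/subsetP => -[z' t']; rewrite !inE /= => h'.
by case: (eo_ferrers o h h') => //; rewrite (negPf nab).
Qed.

End EdgeOrder.

Lemma eo_max (T : finType) (lt : T -> T -> T -> T -> bool) (o : edge_order lt) x0 y0 z0 t0 :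
  lt x0 y0 z0 t0 -> exists c d, forall x y z t, lt x y z t -> lt x y c d.
Proof.
move=> h; have [c [d H]] := eo_min (eo_rev o) h.
by exists c, d => x y z t; apply: H.
Qed.

(** The edges given by [eo_min] and [eo_max] are comparable to each other, hence meet; their common
    vertex becomes [a]. *)
Lemma eo_normal (T : finType) (lt : T -> T -> T -> T -> bool) (o : edge_order lt) x0 y0 z0 t0 :
  lt x0 y0 z0 t0 -> exists a b c, [/\ lt a b a c,
    forall x y z t, lt x y z t -> lt a b z t &
    forall x y z t, lt x y z t -> lt x y a c].
Proof.
move=> h; have [a [b mn]] := eo_min o h; have [c [d mx]] := eo_max o h.
have abcd := mn _ _ _ _ (mx _ _ _ _ h).
have mn' x y z t : lt x y z t -> lt b a z t by move/mn/(eo_symL o).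
have mx' x y z t : lt x y z t -> lt x y d c by move/mx/(eo_symR o).
case: (eo_meet o abcd) => E; subst.
- by exists c, b, d; split=> //; apply: mx h; apply: mn h.
- by exists d, b, c; split=> //; apply: mx' abcd.
- by exists c, a, d; split=> //; apply: mn' abcd.
- by exists d, a, c; split=> //; apply: mx' (mn' _ _ _ _ abcd).
Qed.

(** * Touched and filled triples *)

Definition triples (T : finType) (S : {set T}) :=
  [set X : {set T} | (X \subset S) && (#|X| == 3)].

(* A cherry is a pair of edges pq, ps; a triple carries three of them, and [lt]
   touches it by ordering one of them and fills it by ordering all three. *)
Definition touched (T : finType) (lt : T -> T -> T -> T -> bool) (S : {set T}) :=
  [set X : {set T} | [&& X \subset S, #|X| == 3 &
   [exists p, exists q, exists s, (X == [set p; q; s]) && lt p q p s]]].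

Definition filled (T : finType) (lt : T -> T -> T -> T -> bool) (S : {set T}) :=
  [set X : {set T} | [&& X \subset S, #|X| == 3 &
   [forall p, forall q, forall s,
     (X == [set p; q; s]) ==> lt p q p s || lt p s p q]]].

Lemma card_set3 (T : finType) (x y z : T) :
  (#|[set x; y; z]| == 3) = [&& x != y, x != z & y != z].
Proof.
rewrite setUC cardsU1 cards2 !inE negb_or (eq_sym z) (eq_sym z).
by case: (x == y); case: (x == z); case: (y == z).
Qed.

Lemma cards3P (T : finType) (X : {set T}) : #|X| = 3 -> exists x y z, X = [set x; y; z].
Proof.
move=> X3; have /card_gt0P[x xX] : 0 < #|X| by rewrite X3.
have /eqP/cards2P[y [z [_ E]]] : #|X :\ x| = 2.
  by move: X3; rewrite (cardsD1 x) xX => -[].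
by exists x, y, z; rewrite -setUA -E setD1K.
Qed.

Lemma touched_exists (T : finType) (lt : T -> T -> T -> T -> bool) (S X : {set T}) :
  X \in touched lt S -> [/\ X \subset S, #|X| = 3 &
    exists p q s, X = [set p; q; s] /\ lt p q p s].
Proof.
rewrite inE => /and3P[-> /eqP-> /existsP[p /existsP[q /existsP[s /andP[/eqP-> h]]]]].
by split=> //; exists p, q, s.
Qed.

Lemma filled_all (T : finType) (lt : T -> T -> T -> T -> bool) (S X : {set T}) :
  X \in filled lt S -> [/\ X \subset S, #|X| = 3 &
    forall p q s, X = [set p; q; s] -> lt p q p s \/ lt p s p q].
Proof.
rewrite inE => /and3P[-> /eqP-> H]; split=> // p q s E.
by move: H => /forallP/(_ p)/forallP/(_ q)/forallP/(_ s); rewrite E eqxx => /orP.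
Qed.

Lemma filled_touched (T : finType) (lt : T -> T -> T -> T -> bool) (S : {set T}) :
  filled lt S \subset touched lt S.
Proof.
apply/subsetP=> X /filled_all[sX X3 H]; rewrite inE sX X3 eqxx /=.
have [x [y [z E]]] := cards3P X3.
have [h|h] := H _ _ _ E; apply/existsP; exists x; apply/existsP.
  by exists y; apply/existsP; exists z; rewrite E eqxx.
by exists z; apply/existsP; exists y; rewrite E setUAC eqxx.
Qed.

Ltac set_perm := apply/setP=> ?; rewrite !inE; do ?[case: (_ == _) => //=].

(** * Comparable cherries of an order in normal form *)

Section NormalForm.
Variables (T : finType) (lt : T -> T -> T -> T -> bool) (a b c : T).
Hypothesis o : edge_order lt.
Hypothesis abac : lt a b a c.
Hypothesis ab_min : forall x y z t, lt x y z t -> lt a b z t.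
Hypothesis ac_max : forall x y z t, lt x y z t -> lt x y a c.

Let neq_ab : a <> b. Proof. exact (eo_neqL o abac). Qed.
Let neq_ac : a <> c. Proof. exact (eo_neqR o abac). Qed.
Let neq_bc : b <> c.
Proof. by move=> E; apply: (eo_irr o (x := a) (y := c)); rewrite -{1}E. Qed.

(* The cherries avoiding a, by their third vertex besides b and c. *)
Definition bc_cherry x := [|| lt c x b x, lt c b b x | lt c x c b].

Lemma cherry_neq p q s : lt p q p s -> q <> s.
Proof. by move=> h E; rewrite E in h; case: (eo_irr o h). Qed.

(** Here ps meets ab and pq meets ac. If p is not a, this puts a with b or c, or both b and c, into
    the triple; in the last case the orientation is forced and [bc_cherry] records it. *)
Lemma cherry_cases p q s : lt p q p s ->
  [\/ exists x, [set p; q; s] = [set a; b; x],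
      exists x, [set p; q; s] = [set a; c; x],
      (exists x, [/\ x <> a, bc_cherry x & [set p; q; s] = [set b; c; x]]) |
      p = a /\ [/\ q <> b, q <> c, s <> b & s <> c]].
Proof.
move=> h.
have npq := eo_neqL o h; have nps := eo_neqR o h.
have nqs := cherry_neq h.
have mn := eo_meet o (ab_min h); have mx := eo_meet o (ac_max h).
have [pa|/eqP pa] := eqVneq p a.
  subst p; have [->|/eqP qb] := eqVneq q b; first by constructor 1; exists s.
  have [->|/eqP qc] := eqVneq q c; first by constructor 2; exists s.
  have [->|/eqP sb] := eqVneq s b.
    by constructor 1; exists q; rewrite setUAC.
  have [->|/eqP sc] := eqVneq s c; first by constructor 2; exists q; rewrite setUAC.
  by constructor 4.
have h' := eo_symL o h; have h3 := eo_symR o h'.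
case: mn => En; case: mx => Em; try congruence; subst.
all: try by [constructor 1; eexists; set_perm].
- by constructor 2; exists q; set_perm.
- by constructor 2; exists p; set_perm.
- have [->|/eqP sa] := eqVneq s a; first by constructor 1; exists c; set_perm.
  by constructor 3; exists s; split=> //; rewrite /bc_cherry h' orbT.
- have [->|/eqP qa] := eqVneq q a; first by constructor 1; exists c; set_perm.
  by constructor 3; exists q; split=> //; [rewrite /bc_cherry h !orbT|set_perm].
- by constructor 1; exists p; set_perm.
- by constructor 3; exists p; split=> //; [rewrite /bc_cherry h3|set_perm].
Qed.

(* Two comparabilities g < h and g' < h' force g < h' or g' < h, hence g meets h'
   or g' meets h. *)
Ltac clash h h' :=
  have ? := eo_neqL o h; have ? := eo_neqR o h;
  have ? := eo_neqL o h'; have ? := eo_neqR o h';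
  let h3 := fresh in
  case: (eo_ferrers o h h') => h3;
  first [by case: (eo_irr o h3) | by case: (eo_meet o h3) => ?; congruence].

Lemma axbx_uniq x y : lt a x b x -> lt a y b y -> x = y.
Proof. by move=> h h'; clash h h'. Qed.

Lemma cxax_uniq x y : lt c x a x -> lt c y a y -> x = y.
Proof. by move=> h h'; clash h h'. Qed.

Lemma bc_cherry_neq x : bc_cherry x -> x <> b /\ x <> c.
Proof.
case/or3P=> h; have := eo_neqL o h; have := eo_neqR o h; split; try congruence;
  move=> E; rewrite E in h.
- by case: (eo_irr o (eo_symR o h)).
- by case: (eo_irr o h).
Qed.

Lemma aqas_bc_cherry q s w :
  lt a q a s -> q <> b -> q <> c -> s <> b -> s <> c -> w <> a -> bc_cherry w ->
  q = w \/ s = w.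
Proof.
move=> h qb qc sb sc wa; have [->|/eqP qw] := eqVneq q w; first by left.
have [->|/eqP sw] := eqVneq s w; first by right.
by case/or3P => h'; clash h h'.
Qed.

Ltac clash3 h h1 h2 :=
  have ? := eo_neqL o h1; have ? := eo_neqR o h1;
  have ? := eo_neqL o h2; have ? := eo_neqR o h2;
  let h3 := fresh in
  case: (eo_ferrers o h1 h2) => h3;
  first [by case: (eo_irr o h3) | by case: (eo_meet o h3); congruence | clash h h3].

(** Two different third vertices would be q and s themselves, and then the two cherries clash with
    aq < as or with each other. *)
Lemma bc_cherry_uniq q s w x :
  lt a q a s -> q <> b -> q <> c -> s <> b -> s <> c -> w <> a -> bc_cherry w ->
  x <> a -> bc_cherry x -> x = w.
Proof.
move=> h qb qc sb sc wa Bw xa Bx; apply/eqP/negPn/negP => /eqP xw.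
have [E|E] := aqas_bc_cherry h qb qc sb sc wa Bw;
  have [E'|E'] := aqas_bc_cherry h qb qc sb sc xa Bx; try congruence; subst.
all: case/or3P: Bw => h1; try clash h h1.
all: case/or3P: Bx => h2; try clash h h2.
all: clash3 h h1 h2.
Qed.

(** If x and y differ, cy and bx are disjoint, so ax < ay. The cherry at w then forces w = x or w =
    y and clashes with another comparability. *)
Lemma two_tight_triples x y w : x <> c -> y <> b -> lt a x b x -> lt c y a y ->
  w <> a -> bc_cherry w -> x = y.
Proof.
move=> xc yb h h' wa Bw; have [wb wc] := bc_cherry_neq Bw.
apply/eqP/negPn/negP => /eqP xy.
have xb := eo_neqR o h; have yc := eo_neqL o h'.
have xa := eo_neqL o h; have ya := eo_neqR o h'.
case: (eo_ferrers o h h') => h2; last by case: (eo_meet o h2); congruence.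
case/or3P: Bw => h3.
- have E : w = x by clash h h3.
  by subst; clash h' h3.
- have E : w = y by clash h' h3.
  by subst; clash h2 h3.
- have E : w = x by clash h h3.
  by subst; clash h2 h3.
Qed.

(* Everything that confines the filled triples to {a,b,c,w}, and the touched ones
   to abx, acx and bcw. *)
Definition tetrahedral w :=
  [/\ w <> a, w <> b & w <> c] /\
  [/\ forall x, x <> a -> bc_cherry x -> x = w,
     forall q s, lt a q a s -> q <> b -> q <> c -> s <> b -> s <> c -> False,
     forall x, x <> c -> lt a x b x -> x = w,
     forall x, x <> b -> lt c x a x -> x = w &
     forall x, lt c x b x -> x = w].

(** The triple bcw is a chain cw < cb < bw; every further comparability is tested against it. *)
Lemma chain_tetrahedral w : w <> a -> lt c w c b -> lt c b b w -> tetrahedral w.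
Proof.
move=> wa h h'; have h'' := eo_trans o h h'.
have nwc := eo_neqL o h; have nbw := eo_neqR o h'.
split; first by split; congruence.
split=> [|q s hq qb qc sb sc|||]; try have nqs := cherry_neq hq.
- move=> x xa Bx; have [xb xc] := bc_cherry_neq Bx.
  by case/or3P: Bx => hx; [clash h'' hx|clash h hx|clash h' hx].
- have E : s = w by clash h hq.
  by subst; clash h' hq.
- by move=> x xc hx; clash h'' hx.
- by move=> x xb hx; clash h'' hx.
- by move=> x hx; clash h'' hx.
Qed.

Lemma tight_tetrahedral x : x <> b -> x <> c -> lt c x a x -> lt a x b x -> tetrahedral x.
Proof.
move=> nxb nxc h h'; have h'' := eo_trans o h h'; have nax := eo_neqL o h'.
split; first by split; congruence.
split=> [|q s hq qb qc sb sc|||]; try have nqs := cherry_neq hq.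
- move=> y ya By; have [yb yc] := bc_cherry_neq By.
  by case/or3P: By => hy; [clash h'' hy|clash h hy|clash h' hy].
- have [E|/eqP qx] := eqVneq q x; first by subst; clash h hq.
  have E : s = x by clash h'' hq.
  by subst; clash h' hq.
- by move=> y _ hy; apply: axbx_uniq hy h'.
- by move=> y _ hy; apply: cxax_uniq hy h.
- by move=> y hy; clash h'' hy.
Qed.

(** * Triples touched and filled by one order *)

Lemma filled_cases S X : X \in filled lt S ->
  [\/ X = [set a; b; c],
      exists x, [/\ x <> c, lt a x b x & X = [set a; b; x]],
      exists x, [/\ x <> b, lt c x a x & X = [set a; c; x]] |
      exists x, [/\ x <> a, lt c x b x, lt c x c b, lt c b b x & X = [set b; c; x]]].
Proof.
move=> XF; have [sX X3 H] := filled_all XF.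
have [_ _ [p [q [s [E h]]]]] := touched_exists (subsetP (filled_touched lt S) _ XF).
have {h} := cherry_cases h; rewrite -E.
have neq3 x y z : X = [set x; y; z] -> [/\ x <> y, x <> z & y <> z].
  by move=> EX; move/eqP: X3; rewrite EX card_set3 => /and3P[/eqP ? /eqP ? /eqP ?].
case=> [[x Ex]|[x Ex]|[x [xa Bx Ex]]|[pa [qb qc sb sc]]].
- have [? ax bx] := neq3 _ _ _ Ex.
  have [xc|/eqP xc] := eqVneq x c; first by constructor 1; rewrite Ex xc.
  (* Filling abx orders the cherry at x. Its lower edge must meet ac, so bx < ax is impossible; the
     other orientations below are forced likewise. *)
  constructor 2; exists x; split=> //.
  have /H[h|h] : X = [set x; a; b] by rewrite Ex; set_perm.
    exact (eo_symL o (eo_symR o h)).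
  by case: (eo_meet o (ac_max h)); congruence.
- have [? ax cx] := neq3 _ _ _ Ex.
  have [xb|/eqP xb] := eqVneq x b.
    by constructor 1; rewrite Ex xb; set_perm.
  constructor 3; exists x; split=> //.
  have /H[h|h] : X = [set x; c; a] by rewrite Ex; set_perm.
    exact (eo_symL o (eo_symR o h)).
  by case: (eo_meet o (ab_min h)); congruence.
- have [? bx cx] := neq3 _ _ _ Ex.
  constructor 4; exists x; split=> //.
  + have /H[h|h] : X = [set x; c; b] by rewrite Ex; set_perm.
      exact (eo_symL o (eo_symR o h)).
    by case: (eo_meet o (ab_min h)); congruence.
  + have /H[h|h] : X = [set c; x; b] by rewrite Ex; set_perm.
      by [].
    by case: (eo_meet o (ab_min h)); congruence.
  + have /H[h|h] : X = [set b; c; x] by rewrite Ex; set_perm.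
      exact (eo_symL o h).
    by case: (eo_meet o (ac_max h)); congruence.
(* The edge qs meets neither ab nor ac, so the cherry at q cannot be ordered. *)
- exfalso; rewrite pa in E; have [aq as' qs] := neq3 _ _ _ E.
  have /H[h|h] : X = [set q; a; s] by rewrite E; set_perm.
    by case: (eo_meet o (ab_min h)); congruence.
  by case: (eo_meet o (ac_max h)); congruence.
Qed.

(** The summands count the triples abx, the remaining acx, the bcx with x in [W] and the awx with x
    in [D]; [cherry_cases] allows no others. *)
Lemma touched_card (S W D : {set T}) w :
  a \in S -> b \in S -> c \in S ->
  (forall x, x \in S -> x <> a -> bc_cherry x -> x \in W) ->
  (forall q s, lt a q a s -> q <> b -> q <> c -> s <> b -> s <> c ->
     q \in S -> s \in S -> q = w /\ s \in D \/ s = w /\ q \in D) ->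
  #|touched lt S| <= (#|S| - 2) + (#|S| - 3) + #|W| + #|D|.
Proof.
move=> aS bS cS HW HD.
pose A := ((fun x => [set a; b; x]) @: (S :\ a :\ b)) :|:
  ((fun x => [set a; c; x]) @: (S :\ a :\ b :\ c)) :|:
  ((fun x => [set b; c; x]) @: W) :|: ((fun x => [set a; w; x]) @: D).
have bSa : b \in S :\ a by rewrite !inE bS andbT; apply/eqP; congruence.
have cSab : c \in S :\ a :\ b.
  by rewrite !inE cS andbT; apply/andP; split; apply/eqP; congruence.
have cS1 : #|S :\ a :\ b| = #|S| - 2.
  by rewrite (cardsD1 a S) aS (cardsD1 b (S :\ a)) bSa /= subSS subSS subn0.
have cS2 : #|S :\ a :\ b :\ c| = #|S| - 3.
  by rewrite (cardsD1 a S) aS (cardsD1 b (S :\ a)) bSa (cardsD1 c (S :\ a :\ b)) cSab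
    !add1n !subSS subn0.
have cA : #|A| <= (#|S| - 2) + (#|S| - 3) + #|W| + #|D|.
  rewrite -cS1 -cS2 /A.
  do 3 (apply: leq_trans (leq_card_setU _ _) _; apply: leq_add; last exact: leq_imset_card).
  exact: leq_imset_card.
apply: leq_trans cA; apply: subset_leq_card; apply/subsetP => X.
move=> /touched_exists[sX X3 [p [q [s [E h]]]]].
have neq3 x y z : X = [set x; y; z] -> [/\ x <> y, x <> z & y <> z].
  by move=> EX; move/eqP: X3; rewrite EX card_set3 => /and3P[/eqP ? /eqP ? /eqP ?].
have inS x y z : X = [set x; y; z] -> z \in S.
  by move=> EX; apply: (subsetP sX); rewrite EX !inE eqxx orbT.
have := cherry_cases h; rewrite -E.
have inab x : X = [set a; b; x] -> X \in A.
  move=> Ex; have [? ax bx] := neq3 _ _ _ Ex.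
  rewrite /A !inE; do 3 (apply/orP; left); rewrite Ex; apply: imset_f.
  by rewrite !inE (inS _ _ _ Ex) andbT; apply/andP; split; apply/eqP; congruence.
case=> [[x Ex]|[x Ex]|[x [xa Bx Ex]]|[pa [qb qc sb sc]]].
- exact: inab Ex.
- have [? ax cx] := neq3 _ _ _ Ex.
  have [xb|xb] := eqVneq x b; first by apply: (inab c); rewrite Ex xb setUAC.
  rewrite /A !inE; do 2 (apply/orP; left); apply/orP; right; rewrite Ex; apply: imset_f.
  rewrite !inE (inS _ _ _ Ex) xb /= andbT; apply/andP; split; apply/eqP; congruence.
- rewrite /A !inE; apply/orP; left; apply/orP; right; rewrite Ex; apply: imset_f.
  exact: HW (inS _ _ _ Ex) xa Bx.
- rewrite /A !inE; apply/orP; right; subst p.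
  have sS := inS _ _ _ E; have qS : q \in S by apply: (inS a s); rewrite E setUAC.
  move: E; case: (HD _ _ h qb qc sb sc qS sS) => -[-> yD] ->; last rewrite setUAC.
    exact: imset_f.
  exact: imset_f.
Qed.

(* Third vertices of the triples abx, acx and bcx that may be filled. *)
Let tight_b := [set x | lt a x b x & x != c].
Let tight_c := [set x | lt c x a x & x != b].
Let chain := [set x | [&& x != a, lt c x b x, lt c x c b & lt c b b x]].

Lemma filled_card S :
  #|filled lt S| <= 1 + #|tight_b| + #|tight_c| + #|chain|.
Proof.
apply: leq_trans (_ : #|[set [set a; b; c]] :|: (fun x => [set a; b; x]) @: tight_b :|:
  (fun x => [set a; c; x]) @: tight_c :|: (fun x => [set b; c; x]) @: chain| <= _).
  apply: subset_leq_card; apply/subsetP => X.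
  case/filled_cases => [->|[x [/eqP xc h ->]]|[x [/eqP xb h ->]]|[x [/eqP xa h1 h2 h3 ->]]].
  - by rewrite !inE eqxx.
  - rewrite !inE; apply/orP; left; apply/orP; left; apply/orP; right.
    by apply: imset_f; rewrite inE h.
  - rewrite !inE; apply/orP; left; apply/orP; right.
    by apply: imset_f; rewrite inE h.
  - rewrite !inE; apply/orP; right.
    by apply: imset_f; rewrite inE xa h1 h2 h3.
do 3 (apply: leq_trans (leq_card_setU _ _) _; apply: leq_add; last exact: leq_imset_card).
by rewrite cards1.
Qed.

Lemma tight_b_le1 : #|tight_b| <= 1.
Proof.
by apply/card_le1_eqP => x y; rewrite !inE => /andP[h _] /andP[h' _]; apply: axbx_uniq.
Qed.

Lemma tight_c_le1 : #|tight_c| <= 1.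
Proof.
by apply/card_le1_eqP => x y; rewrite !inE => /andP[h _] /andP[h' _]; apply: cxax_uniq.
Qed.

Lemma card_abc w : w <> a -> w <> b -> w <> c -> #|[set a; b; c; w]| = 4.
Proof.
move=> /eqP wa /eqP wb /eqP wc.
rewrite setUC cardsU1 !inE !negb_or wa wb wc /=; congr (1 + _); apply/eqP.
by rewrite card_set3; apply/and3P; split; apply/eqP; congruence.
Qed.

Lemma tetrahedral_bounds (S : {set T}) w : a \in S -> b \in S -> c \in S -> w \in S ->
  tetrahedral w ->
  #|touched lt S| <= 2 * #|S| - 4 /\
  exists Q : {set T}, [/\ Q \subset S, #|Q| = 4 &
    filled lt S \subset triples Q].
Proof.
move=> aS bS cS wS [[wa wb wc] [HB HC Hb Hc Hbc]].
have cQ := card_abc wa wb wc.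
have sQ : [set a; b; c; w] \subset S by rewrite !subUset !sub1set aS bS cS wS.
have S4 : 4 <= #|S| by rewrite -cQ subset_leq_card.
split.
  (* [W] is {w} and [D] is empty, which gives (|S| - 2) + (|S| - 3) + 1. *)
  have := @touched_card S [set w] set0 w aS bS cS; rewrite cards1 cards0.
  move=> H; apply: leq_trans (H _ _) _.
  - by move=> x _ xa Bx; rewrite inE; apply/eqP; apply: HB.
  - by move=> q s h qb qc sb sc; case: (HC _ _ h qb qc sb sc).
  - by lia.
exists [set a; b; c; w]; split=> //; apply/subsetP=> X XF.
have [_ X3 _] := filled_all XF; rewrite inE X3 eqxx andbT.
case: (filled_cases XF) => [->|[x [xc h ->]]|[x [xb h ->]]|[x [xa h _ _ ->]]].
- by rewrite !subUset !sub1set !inE !eqxx ?orbT.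
- by rewrite (Hb _ xc h) !subUset !sub1set !inE !eqxx ?orbT.
- by rewrite (Hc _ xb h) !subUset !sub1set !inE !eqxx ?orbT.
- by rewrite (Hbc _ h) !subUset !sub1set !inE !eqxx ?orbT.
Qed.

(** A filled bcw is tetrahedral, and so are filled abx and acx together once some [bc_cherry]
    exists. If all touched triples contain a, the order is a star. Otherwise [tight_b] or [tight_c]
    is empty, leaving at most 2 filled triples. *)
Lemma normal_form_bounds (S : {set T}) :
  (forall x y z t, lt x y z t -> [set x; y; z; t] \subset S) ->
  [\/ (exists2 v, v \in S & forall X, X \in touched lt S -> v \in X) /\
      #|filled lt S| <= 3,
      #|touched lt S| <= 3 * #|S| - 8 /\ #|filled lt S| <= 2 |
      #|touched lt S| <= 2 * #|S| - 4 /\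
      exists Q : {set T}, [/\ Q \subset S, #|Q| = 4 &
        filled lt S \subset triples Q]].
Proof.
move=> ltS.
have inS x y z t : lt x y z t -> [/\ x \in S, y \in S, z \in S & t \in S].
  by move/ltS; rewrite !subUset !sub1set -!andbA => /and4P.
have [aS bS _ cS] := inS _ _ _ _ abac.
have [chain0|[w]] := set_0Vmem chain; last first.
  rewrite inE => /and4P[/eqP wa h h1 h2]; constructor 3.
  have [_ wS _ _] := inS _ _ _ _ h.
  exact: tetrahedral_bounds aS bS cS wS (chain_tetrahedral wa h1 h2).
have F3 := filled_card S; rewrite chain0 cards0 addn0 in F3.
have tb1 := tight_b_le1; have tc1 := tight_c_le1.
case: (boolP [forall X in touched lt S, a \in X]) => [/forall_inP star|].
  by constructor 1; split; [exists a|lia].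
case/forall_inPn => X XT aX.
have [w [wS wa Bw]] : exists w, [/\ w \in S, w <> a & bc_cherry w].
  have [sX X3 [p [q [s [E h]]]]] := touched_exists XT.
  have := cherry_cases h; rewrite -E.
  case=> [[x Ex]|[x Ex]|[x [xa Bx Ex]]|[pa _]].
  - by rewrite Ex !inE eqxx in aX.
  - by rewrite Ex !inE eqxx in aX.
  - by exists x; split=> //; apply: (subsetP sX); rewrite Ex !inE eqxx orbT.
  - by rewrite E pa !inE eqxx in aX.
have [wb wc] := bc_cherry_neq Bw.
have S4 : 4 <= #|S|.
  by rewrite -(card_abc wa wb wc) subset_leq_card // !subUset !sub1set aS bS cS wS.
have [[[x xB] [y yC]]|none] : {x | x \in tight_b} * {y | y \in tight_c} +
    {tight_b = set0 \/ tight_c = set0}.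
- have [->|[x xB]] := set_0Vmem tight_b; first by right; left.
  have [->|[y yC]] := set_0Vmem tight_c; first by right; right.
  by left; split; [exists x|exists y].
- move: xB yC; rewrite !inE => /andP[hx /eqP xc] /andP[hy /eqP yb].
  have E := two_tight_triples xc yb hx hy wa Bw; subst y.
  constructor 3; have [_ xS _ _] := inS _ _ _ _ hx.
  exact: tetrahedral_bounds aS bS cS xS (tight_tetrahedral yb xc hy hx).
have F2 : #|filled lt S| <= 2.
  by move: F3 tb1 tc1; case: none => ->; rewrite cards0; clear; lia.
constructor 2; split=> //.
pose S' := S :\ a :\ b :\ c.
have inS' x : x \in S -> x <> a -> x <> b -> x <> c -> x \in S'.
  by move=> xS /eqP xa /eqP xb /eqP xc; rewrite !inE xS xa xb xc.
have cS' : #|S'| = #|S| - 3.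
  have := cardsD1 a S; have := cardsD1 b (S :\ a); have := cardsD1 c (S :\ a :\ b).
  rewrite !inE aS bS cS /= -/S'.
  have -> : c != b by apply/eqP; congruence.
  have -> : c != a by apply/eqP; congruence.
  have -> : b != a by apply/eqP; congruence.
  by move=> /= -> -> ->; rewrite !add1n !subSS subn0.
have wS' : w \in S' by apply: inS'.
pose D := [set y in S' :\ w | lt a w a y || lt a y a w].
have cD : #|D| <= #|S| - 4.
  have := cardsD1 w S'; rewrite wS' cS'.
  have : #|D| <= #|S' :\ w|
    by apply: subset_leq_card; apply/subsetP => y; rewrite inE => /andP[].
  by clear; lia.
have inD q s : lt a q a s -> q <> b -> q <> c -> s <> b -> s <> c ->
    q \in S -> s \in S -> q = w /\ s \in D \/ s = w /\ q \in D.
  move=> h qb qc sb sc qS sS.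
  have qs := cherry_neq h; have qa := eo_neqL o h; have sa := eo_neqR o h.
  have [E|E] := aqas_bc_cherry h qb qc sb sc wa Bw; [left|right]; split=> //; subst.
    rewrite inE h andbT in_setD1; apply/andP; split; first by apply/eqP; congruence.
    by apply: inS'; congruence.
  rewrite inE h orbT andbT in_setD1; apply/andP; split; first by apply/eqP; congruence.
  by apply: inS'; congruence.
(* If [D] is empty, [W] may be all |S| - 3 vertices besides a, b, c. Otherwise [bc_cherry_uniq]
   reduces [W] to {w}, while [D] has at most |S| - 4 elements. Both sums are 3|S| - 8. *)
have [D0|[y]] := set_0Vmem D.
  have H := @touched_card S S' D w aS bS cS _ inD; rewrite D0 cards0 cS' in H.
  apply: leq_trans (H _) _; last by clear - S4 cD; lia.
  by move=> x xS xa /bc_cherry_neq[xb xc]; apply: inS'.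
rewrite !inE => /andP[/and5P[/eqP yw /eqP yc /eqP yb /eqP ya yS] h].
have H := @touched_card S [set w] D w aS bS cS _ inD; rewrite cards1 in H.
apply: leq_trans (H _) _; last by clear - S4 cD; lia.
move=> x xS xa Bx; rewrite inE; apply/eqP.
by case/orP: h => h; exact: (bc_cherry_uniq h _ _ _ _ wa Bw xa Bx).
Qed.

End NormalForm.

(** * Counting triples *)

Lemma edge_order_bounds (T : finType) (lt : T -> T -> T -> T -> bool) (S : {set T}) :
  edge_order lt -> S != set0 ->
  (forall x y z t, lt x y z t -> [set x; y; z; t] \subset S) ->
  [\/ (exists2 v, v \in S & forall X, X \in touched lt S -> v \in X) /\
      #|filled lt S| <= 3,
      #|touched lt S| <= 3 * #|S| - 8 /\ #|filled lt S| <= 2 |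
      #|touched lt S| <= 2 * #|S| - 4 /\
      exists Q : {set T}, [/\ Q \subset S, #|Q| = 4 &
        filled lt S \subset triples Q]].
Proof.
move=> o /set0Pn[v vS] ltS.
have [T0|[X /touched_exists[_ _ [p [q [s [_ h]]]]]]] := set_0Vmem (touched lt S).
  (* An order that touches no triple counts as a star at any vertex. *)
  constructor 1; split; first by exists v => // X; rewrite T0 inE.
  by have := filled_touched lt S; rewrite T0 subset0 => /eqP->; rewrite cards0.
have [a [b [c [abac mn mx]]]] := eo_normal o h.
exact: normal_form_bounds o abac mn mx _ ltS.
Qed.

Lemma touched_triples (T : finType) (lt : T -> T -> T -> T -> bool) (S : {set T}) :
  touched lt S \subset triples S.
Proof. by apply/subsetP=> X /touched_exists[sX X3 _]; rewrite inE sX X3. Qed.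

(** The triples of [S] avoiding v are disjoint from [A]. *)
Lemma card_star (T : finType) (S : {set T}) v (A : {set {set T}}) :
  v \in S -> A \subset triples S -> (forall X, X \in A -> v \in X) ->
  #|A| + 'C(#|S|.-1, 3) <= 'C(#|S|, 3).
Proof.
move=> vS sA vA.
have -> : #|S|.-1 = #|S :\ v| by rewrite (cardsD1 v S) vS.
rewrite -!cards_draws -!/(triples _).
have dj : [disjoint A & triples (S :\ v)].
  apply/pred0P => X /=; apply/negP => /andP[/vA vX]; rewrite inE => /andP[/subsetP sX _].
  by have := sX _ vX; rewrite !inE eqxx.
have := (leq_card_setU A (triples (S :\ v))).2; rewrite dj => /eqP <-.
apply: subset_leq_card; rewrite subUset sA; apply/subsetP=> X; rewrite !inE.
by case/andP=> sX ->; rewrite (subset_trans sX) ?subD1set.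
Qed.

Section Cover.
Variables (T I : finType) (lt : I -> T -> T -> T -> T -> bool).
Variables (J : {set I}) (S : {set T}).
Hypothesis cov : forall p q s, p \in S -> q \in S -> s \in S ->
  p <> q -> p <> s -> q <> s ->
  exists2 i, i \in J & lt i p q p s \/ lt i p s p q.

Let weight X := \sum_(i in J) ((X \in touched (lt i) S) + (X \in filled (lt i) S)).

(** An order touching X either fills it, and so counts twice, or leaves some cherry of X to a second
    order. *)
Lemma weight_ge2 X : X \in triples S -> 2 <= weight X.
Proof.
rewrite inE => /andP[sX /eqP X3].
have covX p q s : X = [set p; q; s] -> exists i, [/\ i \in J,
    X \in touched (lt i) S & lt i p q p s || lt i p s p q].
  move=> E; move/eqP: (X3); rewrite E card_set3 => /and3P[/eqP pq /eqP ps /eqP qs].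
  move: sX; rewrite E !subUset !sub1set -andbA => /and3P[pS qS sS].
  have [i iJ h] := cov pS qS sS pq ps qs.
  exists i; split=> //; last by apply/orP.
  rewrite -E inE X3 E !subUset !sub1set pS qS sS eqxx /=.
  case: h => h; apply/existsP; exists p; apply/existsP.
    by exists q; apply/existsP; exists s; rewrite eqxx.
  by exists s; apply/existsP; exists q; rewrite setUAC eqxx.
have [p [q [s E]]] := cards3P X3.
have [i [iJ XT _]] := covX _ _ _ E.
rewrite /weight (bigD1 i iJ) /= XT.
have [//|] := boolP (X \in filled (lt i) S).
rewrite inE sX X3 eqxx /=.
case/forallPn=> p' /forallPn[q' /forallPn[s']].
rewrite negb_imply => /andP[/eqP E' nh].
have [j [jJ XTj hj]] := covX _ _ _ E'.
have ji : j != i by apply: contraNneq nh => <-.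
have ge2 x y : 1 < 1 + 0 + (1 + x + y) by clear; lia.
by rewrite (bigD1 j) /=; [rewrite XTj; exact: ge2|apply/andP].
Qed.

Lemma sum_weight :
  \sum_(X in triples S) weight X <=
  \sum_(i in J) (#|touched (lt i) S| + #|filled (lt i) S|).
Proof.
rewrite /weight exchange_big /=; apply: leq_sum => i iJ.
have sumin (A : {set {set T}}) : \sum_(X in triples S) (X \in A) <= #|A|.
  rewrite -sum1_card big_mkcond [leqRHS]big_mkcond /=.
  by apply: leq_sum => X _; case: (X \in A); case: (X \in triples S).
by rewrite big_split leq_add.
Qed.

Lemma card_triples_bound :
  2 * 'C(#|S|, 3) <= \sum_(i in J) (#|touched (lt i) S| + #|filled (lt i) S|).
Proof.
apply: leq_trans sum_weight; rewrite -cards_draws mulnC -sum_nat_const.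
exact: leq_sum weight_ge2.
Qed.

End Cover.

(** * How many orders a cover needs *)

Lemma bin3_bound n m s :
  5 <= n -> 2 * 'C(n, 3) <= s -> s <= m * (3 * n - 6) -> n - 2 <= m.
Proof.
case: n => [|[|[|k]]] // k2 le1 le2; rewrite leqNgt; apply/negP => mk.
have {mk} mk : m <= k by lia.
(* With n = k + 3, the assumption m <= k leads to (k + 3)(k + 2) <= 9k, that is (k - 2)^2 + 2 <=
   0. *)
have {le2} le2 : s <= k * (3 * k.+1).
  by apply: leq_trans le2 _; apply: leq_mul => //; lia.
have := bin_ffact k.+3 3; rewrite !ffactnS ffactn0 muln1 /= (_ : 3`! = 6) //.
move: 'C(k.+3, 3) le1 => C le1 C6.
have : k.+3 * k.+2 * k.+1 <= 9 * k * k.+1 by rewrite -mulnA -C6; nia.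
by rewrite leq_pmul2r //; nia.
Qed.

Lemma cover_bound_large (T I : finType) (lt : I -> T -> T -> T -> T -> bool)
    (J : {set I}) (S : {set T}) :
  5 <= #|S| ->
  2 * 'C(#|S|, 3) <= \sum_(i in J) (#|touched (lt i) S| + #|filled (lt i) S|) ->
  (forall i, i \in J -> #|touched (lt i) S| + #|filled (lt i) S| <= 3 * #|S| - 6) ->
  #|S| - 2 <= #|J|.
Proof.
move=> S5 sumJ bnd; apply: bin3_bound S5 sumJ _.
by rewrite -sum_nat_const; apply: leq_sum.
Qed.

(** The ten triples need total weight 20 and one order supplies at most 6 + 4, so two orders would
    both be tight. *)
Lemma cover_bound_five (T I : finType) (lt : I -> T -> T -> T -> T -> bool)
    (J : {set I}) (S : {set T}) :
  #|S| = 5 ->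
  (forall X, X \in triples S ->
     2 <= \sum_(i in J) ((X \in touched (lt i) S) + (X \in filled (lt i) S))) ->
  (forall i, i \in J ->
     #|touched (lt i) S| + #|filled (lt i) S| <= 9 \/
     #|touched (lt i) S| <= 6 /\ exists Q : {set T}, [/\ Q \subset S, #|Q| = 4 &
        filled (lt i) S \subset triples Q]) ->
  3 <= #|J|.
Proof.
move=> S5 wt bnd; rewrite ltnNge; apply/negP => J2.
have cT : #|triples S| = 10 by rewrite cards_draws S5.
have sumle := sum_weight lt J S.
have cQ (Q : {set T}) : #|Q| = 4 -> #|triples Q| = 4 by move=> Q4; rewrite cards_draws Q4.
have bnd10 i : i \in J -> #|touched (lt i) S| + #|filled (lt i) S| <= 10.
  case/bnd => [|[t6 [Q [_ /cQ Q4 /subset_leq_card]]]]; first by clear; lia.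
  by move: t6; rewrite Q4; clear; lia.
have sum20 : 20 <= \sum_(X in triples S)
    \sum_(i in J) ((X \in touched (lt i) S) + (X \in filled (lt i) S)).
  by rewrite -[20]/(10 * 2) -cT -sum_nat_const; apply: leq_sum wt.
have := leq_trans sum20 sumle.
case: (ltngtP #|J| 2) J2 => // [J1|/eqP/cards2P[i [j [ij EJ]]]] _ sumJ.
  have : \sum_(i in J) (#|touched (lt i) S| + #|filled (lt i) S|) <= #|J| * 10.
    by rewrite -sum_nat_const; apply: leq_sum.
  by lia.
have iJ : i \in J by rewrite EJ !inE eqxx.
have jJ : j \in J by rewrite EJ !inE eqxx orbT.
have sum2 (F : I -> nat) : \sum_(k in J) F k = F i + F j.
  by rewrite EJ big_setU1 ?inE //= big_set1.
rewrite sum2 in sumJ.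
have filledQ k : k \in J -> 10 <= #|touched (lt k) S| + #|filled (lt k) S| ->
    exists Q : {set T}, [/\ Q \subset S, #|Q| = 4 & filled (lt k) S = triples Q].
  move=> kJ k10; case: (bnd k kJ) => [|[t6 [Q [sQ Q4 sF]]]]; first by lia.
  exists Q; split=> //; apply/eqP; rewrite eqEcard sF cQ //; lia.
have bi := bnd10 _ iJ; have bj := bnd10 _ jJ.
have [|Q [sQ Q4 EQ]] := filledQ i iJ; first by clear - sumJ bj; lia.
have [|Q' [sQ' Q'4 EQ']] := filledQ j jJ; first by clear - sumJ bi; lia.
(* Two 4-subsets of a 5-set share at least three vertices, hence a triple. *)
have QQ : 3 <= #|Q :&: Q'|.
  have := cardsUI Q Q'; rewrite Q4 Q'4.
  have : #|Q :|: Q'| <= 5 by rewrite -S5 subset_leq_card // subUset sQ.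
  by lia.
have [X] : exists X, X \in triples (Q :&: Q').
  by apply/card_gt0P; rewrite cards_draws bin_gt0.
rewrite inE subsetI => /andP[/andP[XQ XQ'] X3].
have XS : X \in triples S by rewrite inE X3 (subset_trans XQ).
have XF : X \in filled (lt i) S by rewrite EQ inE XQ.
have XF' : X \in filled (lt j) S by rewrite EQ' inE XQ'.
(* The triple [X] is counted four times, every other one at least twice. *)
have : 22 <= \sum_(X in triples S)
    \sum_(i in J) ((X \in touched (lt i) S) + (X \in filled (lt i) S)).
  rewrite (bigD1 X) //= sum2 XF XF' !(subsetP (filled_touched _ _) X) //.
  rewrite -[22]/(4 + 9 * 2); apply: leq_add => //.
  have -> : 9 = #|triples S :\ X|.
    by have := cardsD1 X (triples S); rewrite XS cT => -[].
  rewrite -sum_nat_const (eq_bigl (fun Y => (Y \in triples S) && (Y != X))); last first.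
    by move=> Y; rewrite in_setD1 andbC.
  by apply: leq_sum => Y /andP[/wt].
by move=> /leq_trans/(_ sumle); rewrite sum2; clear - bi bj; lia.
Qed.

Theorem edge_order_cover (T I : finType) (lt : I -> T -> T -> T -> T -> bool)
    (J : {set I}) (S : {set T}) :
  (forall i, edge_order (lt i)) -> 5 <= #|S| ->
  (forall p q s, p \in S -> q \in S -> s \in S -> p <> q -> p <> s -> q <> s ->
    exists2 i, i \in J & lt i p q p s \/ lt i p s p q) ->
  #|S| - 2 <= #|J|.
Proof.
move=> o; have [n] := ubnP #|S|; elim: n J S => // n IHn J S Sn S5 cov.
pose lt' i x y z t := lt i x y z t && ([set x; y; z; t] \subset S).
have o' i : edge_order (lt' i) by apply: eo_restrict.
have cov' p q s : p \in S -> q \in S -> s \in S -> p <> q -> p <> s -> q <> s ->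
    exists2 i, i \in J & lt' i p q p s \/ lt' i p s p q.
  move=> pS qS sS pq ps qs; have [i iJ h] := cov p q s pS qS sS pq ps qs.
  by exists i => //; rewrite /lt' !subUset !sub1set pS qS sS !andbT.
have S0 : S != set0 by rewrite -card_gt0; lia.
have lt'S i x y z t : lt' i x y z t -> [set x; y; z; t] \subset S by case/andP.
have bnd i := edge_order_bounds (o' i) S0 (@lt'S i).
have [S5'|S6] : #|S| = 5 \/ 6 <= #|S| by lia.
  rewrite S5'; apply: (@cover_bound_five _ _ lt' J S S5').
    exact: weight_ge2.
  move=> i iJ; rewrite S5' in bnd; case: (bnd i) => [[[v vS star] F3]|[T7 F2]|[T6 FQ]].
  (* A star touches at most C(5,3) - C(4,3) = 6 triples, so its weight is at most 6 + 3. *)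
  - have := card_star vS (touched_triples (lt' i) S) star.
    rewrite S5' -[_ <= _]/(_ + 4 <= 6 + 4) leq_add2r => T6.
    by left; apply: leq_add T6 F3.
  - by left; lia.
  - by right.
have [/exists_inP[i iJ /exists_inP[v vS /forall_inP star]]|nostar] :=
  boolP [exists i in J, [exists v in S, [forall X in touched (lt' i) S, v \in X]]].
  have cSv := cardsD1 v S; have cJi := cardsD1 i J; rewrite vS in cSv; rewrite iJ in cJi.
  have : #|S :\ v| - 2 <= #|J :\ i|.
    apply: IHn; [by lia|by lia|] => p q s; rewrite !in_setD1.
    move=> /andP[pv pS] /andP[qv qS] /andP[sv sS] pq ps qs.
    have [j jJ h] := cov' p q s pS qS sS pq ps qs.
    exists j; last by case: h => /andP[h _]; [left|right].
    rewrite in_setD1 jJ andbT; apply/eqP => E; subst j.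
    have /star : [set p; q; s] \in touched (lt' i) S.
      rewrite inE !subUset !sub1set pS qS sS card_set3; apply/andP; split=> //.
      apply/andP; split; first by apply/and3P; split; apply/eqP.
      case: h => h; apply/existsP; exists p; apply/existsP.
        by exists q; apply/existsP; exists s; rewrite eqxx.
      by exists s; apply/existsP; exists q; rewrite setUAC eqxx.
    by rewrite !inE !(eq_sym v) (negPf pv) (negPf qv) (negPf sv).
  by lia.
apply: (@cover_bound_large _ _ lt' J S S5 (card_triples_bound cov')) => i iJ.
case: (bnd i) => [[[v vS star] F3]|[T7 F2]|[T6 [Q [_ Q4 FQ]]]]; first 1 last.
- by lia.
(* The weight is at most (2|S| - 4) + 4, which is within 3|S| - 6 only from |S| = 6 on. *)
- have := subset_leq_card FQ; rewrite cards_draws Q4 -[_ <= _]/(_ <= 4) => F4.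
  by apply: leq_trans (leq_add T6 F4) _; clear - S6; lia.
case/negP: nostar; apply/exists_inP; exists i => //.
by apply/exists_inP; exists v => //; apply/forall_inP.
Qed.

(** * Boxes of KG(n, 2) *)

Lemma cards2_ends (m : nat) : #|[set ord0; ord_max : 'I_m.+2]| == 2.
Proof. by rewrite cards2. Qed.

(** [insubd] falls back on the pair of end vertices when x = y. *)
Definition kneser_pair (m : nat) (x y : 'I_m.+2) : kneser m.+2 2 :=
  insubd (Sub [set ord0; ord_max] (cards2_ends m) : kneser_vertex m.+2 2) [set x; y].

Lemma val_kneser_pair (m : nat) (x y : 'I_m.+2) :
  x != y -> val (kneser_pair x y) = [set x; y].
Proof. by move=> xy; rewrite val_insubd (cards2 x y) xy. Qed.

Lemma kneser_pairC (m : nat) (x y : 'I_m.+2) : kneser_pair x y = kneser_pair y x.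
Proof. by rewrite /kneser_pair (setUC [set x]). Qed.

(* When c lies in the pair A, the sum is the other element of A. *)
Definition star_lo (m : nat) (c : 'I_m.+2) (A : {set 'I_m.+2}) : nat :=
  if c \in A then \sum_(p in A :\ c) p else ord0 \in A.

(** A pair missing c gets [0, m + 1], cut to start at 1 if it contains [ord0] and to stop at m if it
    contains [ord_max]. It thus avoids the extreme points of the pairs that it meets there, but no
    point of a disjoint pair. *)
Definition star_hi (m : nat) (c : 'I_m.+2) (A : {set 'I_m.+2}) : nat :=
  if c \in A then \sum_(p in A :\ c) p else m.+1 - (ord_max \in A).

Lemma star_pair (m : nat) (c p : 'I_m.+2) : c != p ->
  (star_lo c [set c; p] = p) * (star_hi c [set c; p] = p).
Proof.
move=> cp; rewrite /star_lo /star_hi !inE eqxx /=.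
by rewrite setU1K ?inE // big_set1.
Qed.

(** The worst case is the pair of both end vertices, with interval [1, m]. *)
Lemma star_le (m : nat) (c : 'I_m.+2) (A : {set 'I_m.+2}) : 0 < m ->
  star_lo c A <= star_hi c A.
Proof.
by rewrite /star_lo /star_hi; case: ifP => // _;
  case: (ord0 \in A); case: (ord_max \in A); lia.
Qed.

Lemma cards2_through (T : finType) (c : T) (A : {set T}) :
  #|A| = 2 -> c \in A -> exists2 p, c != p & A = [set c; p].
Proof.
move=> A2 cA; have /eqP/cards1P[p E] : #|A :\ c| = 1.
  by move: A2; rewrite (cardsD1 c) cA => -[].
exists p; last by rewrite -(setD1K cA) E.
by have := set11 p; rewrite -E !inE eq_sym => /andP[].
Qed.

Lemma star_le_disjoint (m : nat) (c : 'I_m.+2) (A B : {set 'I_m.+2}) :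
  0 < m -> #|A| = 2 -> #|B| = 2 -> [disjoint A & B] ->
  star_lo c A <= star_hi c B.
Proof.
move=> m0 A2 B2 dAB.
have ninB x : x \in A -> x \notin B by move=> xA; rewrite (disjointFr dAB).
have [cA|cA] := boolP (c \in A).
  have [p cp EA] := cards2_through A2 cA; rewrite EA (star_pair cp).1.
  rewrite /star_hi (negPf (ninB _ cA)); have := ltn_ord p.
  have : p \notin B by apply: ninB; rewrite EA !inE eqxx orbT.
  have [->|pm] := eqVneq p ord_max; first by move/negPf=> ->; rewrite subn0.
  by have {pm} : p != m.+1 :> nat by []; case: (_ \in B) => /=; lia.
have [cB|cB] := boolP (c \in B).
  have [p cp EB] := cards2_through B2 cB; rewrite EB (star_pair cp).2.
  rewrite /star_lo (negPf cA); case: (boolP (ord0 \in A)) => //= /ninB.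
  by rewrite EB !inE negb_or => /andP[_]; rewrite eq_sym -lt0n.
rewrite /star_lo /star_hi (negPf cA) (negPf cB).
by case: (ord0 \in A); case: (ord_max \in B); lia.
Qed.

Definition center (m : nat) (i : 'I_m) : 'I_m.+2 := inord i.+1.

Lemma centerP (m : nat) (c : 'I_m.+2) :
  c != ord0 -> c != ord_max -> exists i : 'I_m, center i = c.
Proof.
move=> c0 cm; have {c0} c0 : 0 < c by rewrite lt0n.
have {cm} cm : c < m.+1 by have := ltn_ord c; have : c != m.+1 :> nat by []; lia.
have im : c.-1 < m by lia.
by exists (Ordinal im); apply: val_inj; rewrite /= inordK /=; lia.
Qed.

Definition star_disjoint (m : nat) (c : 'I_m.+2) (A B : {set 'I_m.+2}) :=
  star_hi c A < star_lo c B \/ star_hi c B < star_lo c A.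

(** In the coordinate of p the pair sp is the extreme point s, and sq, which contains s but misses
    p, is cut short of it. *)
Lemma star_disjoint_end (m : nat) (s p q : 'I_m.+2) :
  s != p -> p != q -> s \in [set ord0; ord_max] -> p \notin [set ord0; ord_max] ->
  exists i : 'I_m, star_disjoint (center i) [set s; p] [set s; q].
Proof.
move=> sp pq; rewrite !inE negb_or => s_end /andP[p0 pm].
have [i Ei] := centerP p0 pm; exists i; rewrite /star_disjoint Ei.
have [-> ->] : star_lo p [set s; p] = s /\ star_hi p [set s; p] = s.
  by rewrite setUC !star_pair // eq_sym.
rewrite /star_lo /star_hi !inE (eq_sym p s) (negPf sp) (negPf pq) /=.
by case/orP: s_end => /eqP ->; rewrite !eqxx /=; [left|right; lia].
Qed.

(** If s is not an end vertex, its own coordinate has the two pairs at distinct points. Otherwise p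
    or q is not an end vertex, and [star_disjoint_end] applies to it. *)
Lemma star_separates (m : nat) (s p q : 'I_m.+2) : s != p -> s != q -> p != q ->
  exists i : 'I_m, star_disjoint (center i) [set s; p] [set s; q].
Proof.
move=> sp sq pq; have [s_end|] := boolP (s \in [set ord0; ord_max]); last first.
  rewrite !inE negb_or => /andP[s0 sm]; have [i Ei] := centerP s0 sm.
  exists i; rewrite /star_disjoint Ei !(star_pair sp) !(star_pair sq).
  by apply/orP; rewrite -neq_ltn.
have [p_end|] := boolP (p \in [set ord0; ord_max]); last exact: star_disjoint_end.
have q_end : q \notin [set ord0; ord_max].
  move: s_end p_end sp; rewrite !inE negb_or.
  case/orP=> /eqP Es /orP[] /eqP Ep; rewrite Es Ep ?eqxx // -Es -Ep => _.
    by rewrite ![q == _]eq_sym sq pq.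
  by rewrite ![q == _]eq_sym sq pq.
have qp : q != p by rewrite eq_sym.
have [i] := star_disjoint_end sq qp s_end q_end.
by exists i; rewrite /star_disjoint or_comm.
Qed.

(** * The two bounds on the boxicity *)

Local Open Scope ring_scope.

Lemma box_representable_kneser2_ge (R : realType) (n d : nat) :
  (5 <= n)%N -> box_representable R (kneser n 2) d -> (n - 2 <= d)%N.
Proof.
case: n => [//|[//|m]] m5 [B [Bbox Badj]].
have [lo loP] := choice Bbox; have {loP} [hi loP] := choice loP.
have le_lohi v i : lo v 0 i <= hi v 0 i by have [/(_ i)] := loP v.
have inB v (x : 'rV[R]_d) : B v x <-> forall i, lo v 0 i <= x 0 i <= hi v 0 i.
  by have [_ ->] := loP v; split=> h i; have := h i; rewrite in_itv.
pose e := @kneser_pair m.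
(* The conditions [x != y] and [z != t] exclude the default value of [kneser_pair]. *)
pose lt i x y z t := [&& x != y, z != t & hi (e x y) 0 i < lo (e z t) 0 i].
have nmeet u v : u != v -> adj u v <->
    forall i, (lo u 0 i <= hi v 0 i) /\ (lo v 0 i <= hi u 0 i).
  move=> uv; split=> [/(Badj _ _ uv)[x [/inB xu /inB xv]] i|h].
    have /andP[lu hu] := xu i; have /andP[lv hv] := xv i.
    by split; [exact: le_trans lu hv|exact: le_trans lv hu].
  apply/(Badj _ _ uv); exists (\row_i Num.max (lo u 0 i) (lo v 0 i)).
  by split; apply/inB => i; have [uv_i vu_i] := h i;
    rewrite mxE le_max ge_max !lexx ?orbT !le_lohi ?uv_i ?vu_i.
have o i : edge_order (lt i).
  split=> [x y z t|x y z t|x y|x y z t|x y z t|x y z t|x y z t x' y' z' t'].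
  - by rewrite /lt /e eq_sym kneser_pairC.
  - by rewrite /lt /e (eq_sym z) (kneser_pairC z).
  - by rewrite /lt ltNge le_lohi !andbF.
  - by case/and3P => /eqP.
  - by case/and3P => _ /eqP.
  (* Disjoint pairs are adjacent, so their intervals overlap in every coordinate, against h. *)
  - case/and3P => xy zt h.
    have exyzt : e x y != e z t.
      by apply: contraTneq h => ->; rewrite -leNgt le_lohi.
    have [dis|] := boolP [disjoint [set x; y] & [set z; t]].
      have : adj (e x y) (e z t) by rewrite /adj /= /kneser_adj exyzt !val_kneser_pair.
      by move/(nmeet _ _ exyzt)/(_ i) => [_]; rewrite leNgt h.
    rewrite -setI_eq0 => /set0Pn[u]; rewrite !inE.
    by case/andP=> /orP[] /eqP -> /orP[] /eqP ->;
      [constructor 1|constructor 2|constructor 3|constructor 4].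
  - rewrite /lt => /and3P[-> -> h] /and3P[-> -> h'] /=.
    have [le1|lt1] := leP (lo (e z' t') 0 i) (hi (e x y) 0 i); last by left.
    by right; apply: lt_le_trans h' _; apply: le_trans le1 (ltW h).
have := @edge_order_cover _ _ lt [set: 'I_d] [set: 'I_m.+2] o.
rewrite !cardsT !card_ord => /(_ m5); apply=> p q s _ _ _ pq ps qs.
have /eqP pq' := pq; have /eqP ps' := ps; have /eqP qs' := qs.
have ne : e p q != e p s.
  apply/eqP => /(congr1 val); rewrite !val_kneser_pair // => /setP/(_ q).
  by rewrite !inE eqxx orbT (eq_sym q) (negPf pq') (negPf qs').
have nadj : ~ adj (e p q) (e p s).
  rewrite /adj /= /kneser_adj ne !val_kneser_pair //= => /pred0P/(_ p) /=.
  by rewrite !inE eqxx.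
(* If no coordinate ordered this cherry, all its intervals would overlap and the two meeting pairs
   would be adjacent. *)
apply: contrapT => ncov; apply: nadj; apply/(nmeet _ _ ne) => i.
split; rewrite leNgt; apply/negP => h; apply: ncov; exists i; rewrite ?inE //.
  by right; rewrite /lt pq' ps' h.
by left; rewrite /lt pq' ps' h.
Qed.

Lemma box_representable_kneser2 (R : realType) (n : nat) :
  (3 <= n)%N -> box_representable R (kneser n 2) (n - 2).
Proof.
case: n => [//|[//|m]] m0; rewrite !subSS subn0.
pose lo (v : kneser m.+2 2) : 'rV[R]_m := \row_i (star_lo (center i) (val v))%:R.
pose hi (v : kneser m.+2 2) : 'rV[R]_m := \row_i (star_hi (center i) (val v))%:R.
have card2 (v : kneser m.+2 2) : #|val v| = 2 by apply/eqP/(valP v).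
have lohi v i : lo v 0 i <= hi v 0 i by rewrite !mxE ler_nat star_le.
exists (fun v x => forall i, x 0 i \in `[lo v 0 i, hi v 0 i]); split=> [v|u v uv].
  by exists (lo v), (hi v).
rewrite /adj /= /kneser_adj uv /=; split=> [dis|[x [xu xv]]].
  exists (\row_i Num.max (lo u 0 i) (lo v 0 i)).
  have le_uv i : lo u 0 i <= hi v 0 i.
    by rewrite !mxE ler_nat; apply: star_le_disjoint.
  have le_vu i : lo v 0 i <= hi u 0 i.
    by rewrite !mxE ler_nat; apply: star_le_disjoint; rewrite // disjoint_sym.
  by split=> i; rewrite [X in X \in _]mxE in_itv /= le_max ge_max
    lexx ?orbT ?lohi ?le_uv ?le_vu.
apply/negPn/negP; rewrite -setI_eq0 => /set0Pn[s].
rewrite inE => /andP[su sv].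
have [p sp Eu] := cards2_through (card2 u) su.
have [q sq Ev] := cards2_through (card2 v) sv.
have pq : p != q by apply: contraNneq uv => E; apply/eqP/val_inj; rewrite Eu Ev E.
have [i] := star_separates sp sq pq; rewrite -Eu -Ev.
have := xu i; have := xv i; rewrite !in_itv /= !mxE => /andP[lv hv] /andP[lu hu].
by case; rewrite ltnNge -(ler_nat R) => /negP; apply;
  [apply: le_trans lv hu|apply: le_trans lu hv].
Qed.

Theorem theorem1 (R : realType) :
  (forall n : nat, (5 <= n)%N -> boxicity R (kneser n 2) = (n - 2)%N) /\
  boxicity R (kneser 5 2) = 3%N.
Proof.
have H n : (5 <= n)%N -> boxicity R (kneser n 2) = (n - 2)%N.
  move=> n5; rewrite /boxicity; case: ex_minnP => d /asboolP rep dmin.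
  apply/eqP; rewrite eqn_leq (box_representable_kneser2_ge n5 rep) andbT.
  by apply/dmin/asboolP/box_representable_kneser2; apply: leq_trans n5.
by split=> //; rewrite H.
Qed.
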